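(* For all integers $1\le k\le d$ there is a constant $C_{d,k}$ depending only on $d,k$ such that the following holds. Let $\mu$ be a Borel probability measure on $\mathbb{R}^d$, let $b\ge2$ be an integer, let $\pi\in\Pi_{d,k}$ and let $\alpha\in\mathbb{R}$. Suppose that for $\mu$-a.e. $x$, $$\liminf_{N\to\infty}\frac1N\sum_{n=1}^NH_{1/b}(\pi\mu^{x,n})>\alpha,$$ where $(\mu^{x,n})_{n\ge1}$ is the scenery of $\mu$ at $x$ along $b$-adic cells. Then $$\dim_*\pi\mu>\frac{\alpha}{\log b}-\frac{C_{d,k}}{\log b}.$$
   Context: $\Pi_{d,k}$ is the space of orthogonal projections from $\mathbb{R}^d$ onto $k$-dimensional linear subspaces; the image subspace is identified with $\mathbb{R}^k$ via an orthonormal basis (the choice is immaterial). $\mathbb{R}^d$ and $\mathbb{R}^k$ carry the sup norm and $B_r(x)$ is the closed ball. $\pi\nu$ is the push-forward of $\nu$. For an integer $p\ge 2$, $\mathcal{D}_p$ is the partition of $\mathbb{R}^d$ into cubes $I_1\times\cdots\times I_d$ with each $I_i$ of the form $[\frac jp,\frac{j+1}p)$, $j\in\mathbb{Z}$. For $x\in\mathbb{R}^d$, let $Q_n(x)$ be the cell of $\mathcal{D}_{b^n}$ containing $x$. When $\mu(Q_n(x))>0$, $\mu^{x,n}$ is the probability measure obtained by restricting $\mu$ to $Q_n(x)$, normalizing it to be a probability measure, and pushing it forward by the orientation-preserving homothety taking $Q_n(x)$ to $[0,1)^d$; this sequence is the scenery of $\mu$ at $x$. For a probability measure $\nu$ and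 $r>0$, $H_r(\nu)=-\int\log\nu(B_r(t))\,d\nu(t)$. The lower Hausdorff dimension is $\dim_*\nu=\inf\{\dim A:\nu(A)>0\}$. *)

(* Defs.v *)
From HB Require Import structures.
From mathcomp Require Import all_boot all_order all_algebra archimedean.
From mathcomp Require Import all_classical all_reals all_analysis.
From mathcomp Require Import measurable_realfun.
Import Order.TTheory GRing.Theory Num.Theory.
Import numFieldNormedType.Exports.

Set Implicit Arguments.
Unset Strict Implicit.
Unset Printing Implicit Defensive.

Local Open Scope classical_set_scope.
Local Open Scope ring_scope.

Section borel_matrix.
Context (R : realType) (m n : nat).
Local Notation G := (@open 'M[R]_(m, n)).

HB.instance Definition _ := @isMeasurable.Build (sigma_display G)
  'M[R]_(m, n) <<s G >> (@sigma_algebra0 _ setT G) (@sigma_algebraC _ G)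
  (@sigma_algebra_bigcup _ setT G).

End borel_matrix.

Section borel_matrix_lemmas.
Context (R : realType).

Lemma open_measurable_mx m n (A : set 'M[R]_(m, n)) : open A -> measurable A.
Proof. by move=> oA; exact: sub_sigma_algebra. Qed.

Lemma continuous_measurable_mx m n p q (f : 'M[R]_(m, n) -> 'M[R]_(p, q)) :
  continuous f -> measurable_fun setT f.
Proof.
move=> /continuousP cf; apply: (measurability (@open 'M[R]_(p, q))) => //.
by move=> _ [B oB <-]; rewrite setTI; apply: open_measurable_mx; exact: cf.
Qed.

Lemma measurable_coord m n i j :
  measurable_fun setT (fun A : 'M[R]_(m, n) => A i j : R).
Proof.
apply: (measurability _ (RGenOInfty.measurableE R)).
move=> _ [_ [a ->] <-]; rewrite setTI; apply: open_measurable_mx.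
apply: open_comp; last exact: interval_open.
by move=> x _; exact: coord_continuous.
Qed.

Lemma continuous_mx m n p q (f : 'M[R]_(m, n) -> 'M[R]_(p, q)) :
  (forall i j, continuous (fun A => f A i j)) -> continuous f.
Proof.
move=> cf A U; rewrite nbhs_ballP => -[e /= e0 fAU].
have FA : Filter (nbhs A) by exact: nbhs_filter.
suff : nbhs A [set B | forall i j, ball (f A i j) e (f B i j)].
  by apply: filterS => B fAB; apply: fAU; split.
apply: (@filter_forall _ _
  (fun i B => forall j, ball (f A i j) e (f B i j)) _ FA) => i.
apply: (@filter_forall _ _ (fun j B => ball (f A i j) e (f B i j)) _ FA) => j.
by apply: (cf i j A); exact: nbhsx_ballx.
Qed.

Lemma continuous_mulmxr m n p (A : 'M[R]_(n, p)) :
  continuous (fun x : 'M[R]_(m, n) => x *m A).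
Proof.
apply: continuous_mx => i j.
rewrite (_ : (fun x => _) =
  (fun x : 'M[R]_(m, n) => \sum_k x i k * A k j)); last first.
  by apply/funext => x; rewrite mxE.
move=> x; have Fx : Filter (nbhs x) by exact: nbhs_filter.
apply: (@cvg_big _ _ _ _ _ (@add_continuous R^o) _ (nbhs x)) => k _.
by apply: (@cvgMr_tmp _ _ (nbhs x)); exact: coord_continuous.
Qed.

End borel_matrix_lemmas.

Section scenery.
Context (R : realType) (d : nat).
Implicit Types (p b n : nat) (x y : 'rV[R]_d) (j : 'rV[int]_d).

Definition cell p j : set 'rV[R]_d :=
  [set y | forall i, y 0 i \in
     `[(j 0 i)%:~R / p%:R, ((j 0 i)%:~R + 1) / p%:R[ ].

Definition adic_partition p : set (set 'rV[R]_d) := [set cell p j | j in setT].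

Definition cell_index p x : 'rV[int]_d := \row_i Num.floor (p%:R * x 0 i).

Definition cell_at p x : set 'rV[R]_d := cell p (cell_index p x).

Lemma measurable_cell p j : measurable (cell p j).
Proof.
rewrite (_ : cell p j = \bigcap_(i in setT) ((fun y : 'rV[R]_d => y 0 i) @^-1`
    `[(j 0 i)%:~R / p%:R, ((j 0 i)%:~R + 1) / p%:R[)); last first.
  by apply/seteqP; split => [y + i _|y + i]; [exact|move=> /(_ i Logic.I)].
apply: fin_bigcap_measurable => // i _; rewrite -[X in measurable X]setTI.
by apply: measurable_coord => //; exact: measurable_itv.
Qed.

Lemma cell_atP p x (Q : set 'rV[R]_d) : (0 < p)%N ->
  adic_partition p Q /\ Q x <-> Q = cell_at p x.
Proof.
move=> p0; have p0' : 0 < p%:R :> R by rewrite ltr0n.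
have cellP j : cell p j x <-> j = cell_index p x.
  split=> [jx|-> i].
    apply/rowP => i; rewrite mxE; apply/esym/floor_def; rewrite mulrC.
    by have := jx i; rewrite in_itv/= ler_pdivrMr// ltr_pdivlMr// intrD.
  rewrite mxE in_itv/= ler_pdivrMr// ltr_pdivlMr// mulrC.
  by rewrite -[X in _ + X](mulr1z (1 : R)) -intrD floor_itv.
split=> [[[j _ <-] /cellP ->] //|->].
by split; [exists (cell_index p x)|exact/cellP].
Qed.

Definition rescale p j y : 'rV[R]_d := p%:R *: y - map_mx intr j.

Lemma rescale_cell p j : (0 < p)%N ->
  rescale p j @` cell p j = [set z | forall i, z 0 i \in `[0, 1[ ].
Proof.
move=> p0; have p0' : 0 < p%:R :> R by rewrite ltr0n.
apply/seteqP; split=> [_ [y jy <-] i|z z01].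
  have := jy i; rewrite !in_itv/= !mxE ler_pdivrMr// ltr_pdivlMr//.
  by rewrite subr_ge0 ltrBlDl mulrC.
exists (p%:R^-1 *: (z + map_mx intr j)); last first.
  by rewrite /rescale scalerA divff ?gt_eqF// scale1r addrK.
move=> i; have := z01 i; rewrite !in_itv/= !mxE (mulrC p%:R^-1).
by rewrite ler_pM2r ?invr_gt0// ltr_pM2r ?invr_gt0// lerDr addrC ltrD2l.
Qed.

Lemma measurable_rescale p j : measurable_fun setT (rescale p j).
Proof.
apply: continuous_measurable_mx; apply: continuous_mx => i k.
rewrite (_ : (fun y => _) =
  (fun y : 'rV[R]_d => p%:R * y i k - map_mx intr j i k)); last first.
  by apply/funext => y; rewrite !mxE.
move=> y; have Fy : Filter (nbhs y) by exact: nbhs_filter.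
apply: (@cvgB _ _ _ (nbhs y)); last exact: cvg_cst.
by apply: (@cvgMl_tmp _ _ (nbhs y)); exact: coord_continuous.
Qed.

HB.instance Definition _ p j :=
  isMeasurableFun.Build _ _ _ _ (rescale p j) (measurable_rescale p j).

(* mu^{x,n} in base b; if mu (Q_n(x)) = 0, a mu-null event, the normalization
   falls back on the arbitrary value mu *)
Definition scenery (mu : probability 'rV[R]_d R) b x n :
    probability 'rV[R]_d R :=
  distribution
    (mnormalize (mrestr mu (measurable_cell (b ^ n) (cell_index (b ^ n) x))) mu)
    (rescale (b ^ n) (cell_index (b ^ n) x)).

End scenery.

Section projections.
Context (R : realType) (d k : nat).

Definition orthogonal_projection (P : 'M[R]_d) :=
  [/\ P *m P = P, P^T = P & \rank P = k].

Definition orthonormal_basis (P : 'M[R]_d) (E : 'M[R]_(k, d)) :=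
  E *m E^T = 1%:M /\ (E == P)%MS.

(* x |-> coordinates in the orthonormal family of the rows of E of the
   projection of x *)
Definition proj_coord (P : 'M[R]_d) (E : 'M[R]_(k, d)) (x : 'rV[R]_d) :
  'rV[R]_k := (x *m P) *m E^T.

Lemma proj_coordK P E x : orthonormal_basis P E ->
  proj_coord P E x *m E = x *m P.
Proof.
move=> [E1 /andP[_ /submxP[D PE]]]; rewrite /proj_coord {2}PE PE.
by rewrite -!mulmxA (mulmxA E E^T) E1 mul1mx.
Qed.

Lemma measurable_proj_coord P E : measurable_fun setT (proj_coord P E).
Proof.
rewrite (_ : proj_coord P E = fun x => x *m (P *m E^T)).
  by apply: continuous_measurable_mx => x; exact: continuous_mulmxr.
by apply/funext => x; rewrite mulmxA.
Qed.

HB.instance Definition _ P E :=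
  isMeasurableFun.Build _ _ _ _ (proj_coord P E) (measurable_proj_coord P E).

End projections.

Local Open Scope ereal_scope.

Definition entropy (R : realType) (k : nat) (r : R)
    (nu : probability 'rV[R]_k R) : \bar R :=
  - \int[nu]_t lne (nu (closed_ball t r)).

Section hausdorff.
Context (R : realType) (V : normedModType R).
Implicit Types (A : set V) (U : set V) (s delta : R).

Definition diam U : \bar R :=
  ereal_sup [set `|x - y|%:E | x in U & y in U].

(* diam(U)^s, with the conventions 0^0 = 1 for nonempty sets and 0 for the
   empty set *)
Definition diam_pow s U : \bar R :=
  if U == set0 then 0 else poweR (diam U) s.

Definition delta_cover delta A : set (nat -> set V) :=
  [set F | A `<=` \bigcup_i F i /\ forall i, diam (F i) <= delta%:E].

Definition hausdorff_premeasure s delta A : \bar R :=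
  ereal_inf [set \sum_(0 <= i <oo) diam_pow s (F i) | F in delta_cover delta A].

Definition hausdorff_measure s A : \bar R :=
  ereal_sup [set hausdorff_premeasure s delta A | delta in [set e | (0 < e)%R]].

Definition hausdorff_dim A : \bar R :=
  ereal_inf [set s%:E | s in [set s | (0 <= s)%R /\ hausdorff_measure s A = 0]].

End hausdorff.

Definition lower_dim (R : realType) (k : nat) (nu : probability 'rV[R]_k R)
    : \bar R :=
  ereal_inf [set hausdorff_dim A | A in [set A | measurable A /\ 0 < nu A]].

(* Main.v *)
Require Import Defs.
From mathcomp Require Import all_boot all_order all_algebra.
From mathcomp Require Import all_classical all_reals all_analysis.
From mathcomp Require Import measurable_realfun ring lra.
Import Order.TTheory GRing.Theory Num.Theory.
Import numFieldNormedType.Exports.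

(** The theorem is an instance of the method of local entropy averages.  Write
    [f] for the projection and [Q_n x] for the cell of level [n] of [x].  By the
    mass distribution principle ([hausdorff_null_of_ball_decay]) it is enough
    to bound the mass of [f @^-1` B] by [expR (- gamma * N)] for balls [B] of
    radius about [b ^- N].  The difficulty is that [f @^-1` B] is not a union of
    cells, whereas the hypothesis speaks of the conditional measures on cells.

    The link is a digit [Z_n x]: blow [Q_n x] up to the unit cube, project the
    corner of [Q_(n+1) x], and take the cell of side [b^-1] which contains the
    result.  It is a function of [Q_(n+1) x], it lies within a distance bounded in
    terms of [d] of the digit made from [x] itself, and it takes finitely many
    values.  Let [I_n x] be the information of the digit, that is minus the
    logarithm of its conditional probability given [Q_n x], and [h_n x] the
    conditional mean of [I_n], a Shannon entropy.  Three estimates carry the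
    proof, the constants [L] and [L'] depending on [d] and [k] only.

    - The entropy [H_(1/b)] of the projected scenery is at most [h_n + L]
      ([entropy_scenery_le]): balls contain cells, and the two kinds of digit
      determine each other up to [L] values.
    - Almost everywhere, the sum of the [I_n] is eventually at least that of the
      [h_n - 1] ([ae_info_gt_mean_info]).  An exponential moment bound and the
      Borel-Cantelli lemma suffice, as only one side of the law of large numbers
      is used and a loss of 1 per level is allowed.
    - For each ball [B] of radius [b ^- (N + 1)], the points of [f @^-1` B] at
      which the first [N] informations sum to at least [beta * N] have mass at
      most [expR (- beta * N) * L' ^+ N] ([ball_info_le]).  Indeed, such a point
      has at most [L'] possible digits at each level given its cell, and the
      reciprocal of the conditional probability of a digit, summed over [L']
      digits, has conditional mean at most [L'].  Multiplying over the levels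
      bounds an integral to which Markov's inequality applies.

    Together they give [gamma = alpha - L - 1 - ln L'].  One more unit in the
    constant makes the final inequality strict. *)

Set Implicit Arguments.
Unset Strict Implicit.
Unset Printing Implicit Defensive.

Local Open Scope classical_set_scope.
Local Open Scope ring_scope.

(** * Entropy of finite laws *)

Section finite_entropy.
Context (R : realType).
Implicit Types (D : eqType).

Definition shannon D (S : seq D) (p : D -> R) : R :=
  \sum_(z <- S) - (p z * ln (p z)).

Lemma mul_expRNln_le1 (t : R) : 0 <= t -> t * expR (- ln t) <= 1.
Proof.
rewrite le_eqVlt => /predU1P[<-|t0]; first by rewrite mul0r.
by rewrite expRN lnK ?posrE// divff ?gt_eqF.
Qed.

(** The inequality behind every count of digits below: each value contributes at
    most 1 to the mean of the reciprocal of the probability.  Written as the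
    exponential of [- ln], the reciprocal is 1 on null values, since
    [ln 0 = 0]. *)
Lemma sum_inv_prob_le D (S S' : seq D) (p : D -> R) : (forall z, 0 <= p z) ->
  uniq S -> \sum_(z <- S) (z \in S')%:R * expR (- ln (p z)) * p z
              <= (size S')%:R.
Proof.
move=> p0 uS.
apply: (@le_trans _ _ (\sum_(z <- S | z \in S') 1)).
  rewrite [leRHS]big_mkcond; apply: ler_sum => z _.
  case: ifPn => _; last by rewrite !mul0r.
  by rewrite mul1r mulrC mul_expRNln_le1.
rewrite -big_filter big_const_seq count_predT iter_addr_0 ler_nat.
apply: uniq_leq_size; first exact: filter_uniq.
by move=> z; rewrite mem_filter => /andP[].
Qed.

Lemma expRN_le_quadratic (y : R) : 0 <= y -> expR (- y) <= 1 - y + y ^+ 2.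
Proof.
move=> y0; have y1 : 0 < 1 + y by lra.
rewrite expRN; apply: (@le_trans _ _ (1 + y)^-1).
  by rewrite lef_pV2 ?posrE ?expR_gt0// expR_ge1Dx.
rewrite -[leLHS]mul1r ler_pdivrMr//.
have : 0 <= y ^+ 3 by exact: exprn_ge0.
nra.
Qed.

Lemma sqr_le_expR (y : R) : 0 <= y -> y ^+ 2 <= 4 * expR y.
Proof.
move=> y0; rewrite (_ : expR y = expR (y / 2) ^+ 2); last first.
  by rewrite expr2 -expRD -splitr.
have := expR_ge1Dx (y / 2); have := expR_gt0 (y / 2).
by nra.
Qed.

(** Laplace transform of the information [- ln (p z)], whose mean is the Shannon
    entropy.  The quadratic error needs a second moment, and that is controlled
    by the number of values alone, because [t * ln t ^+ 2 <= 4] on [0, 1]. *)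
Lemma sum_expR_ln_le D (S : seq D) (p : D -> R) (l : R) : 0 <= l ->
  (forall z, 0 <= p z <= 1) -> \sum_(z <- S) p z <= 1 ->
  \sum_(z <- S) p z * expR (l * ln (p z)) <=
    expR (4 * (size S)%:R * l ^+ 2 - l * shannon S p).
Proof.
move=> l0 p01 p1; apply: (le_trans _ (expR_ge1Dx _)).
apply: (@le_trans _ _
    (\sum_(z <- S) (p z + (4 * l ^+ 2 - l * - (p z * ln (p z)))))).
  apply: ler_sum => z _; have /andP[pz0 pz1] := p01 z.
  have I0 : 0 <= - ln (p z) by rewrite oppr_ge0 ln_le0.
  have := expRN_le_quadratic (mulr_ge0 l0 I0); rewrite mulrN opprK => h1.
  have h2 := sqr_le_expR I0; have h3 := mul_expRNln_le1 pz0.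
  have h4 : p z * (- ln (p z)) ^+ 2 <= 4 by nra.
  have h5 : 0 <= l ^+ 2 by exact: sqr_ge0.
  have : p z * expR (l * ln (p z)) <=
         p z * (1 + l * ln (p z) + (- (l * ln (p z))) ^+ 2).
    by rewrite ler_wpM2l.
  have : l ^+ 2 * (p z * (- ln (p z)) ^+ 2) <= l ^+ 2 * 4 by rewrite ler_wpM2l.
  by lra.
rewrite big_split/= sumrB big_const_seq count_predT iter_addr_0 -mulr_natr.
rewrite -mulr_sumr /shannon.
by lra.
Qed.

(** Here [q] is a joint law with marginals [pz] and [pw].  The difference of the
    entropies is the mean of [ln (pz z / pw t)], and [ln u <= u] bounds it by the
    sum of [pz z] over the related pairs, so by the number of values [t] that one
    [z] allows. *)
Lemma shannon_le_related (D1 D2 : eqType) (S : seq D1) (S' : seq D2)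
    (r : D1 -> D2 -> bool) (q : D1 -> D2 -> R) (pz : D1 -> R) (pw : D2 -> R)
    (L : nat) :
  (forall z t, 0 <= q z t) -> (forall z, 0 <= pz z) ->
  {in S, forall z, \sum_(t <- S') q z t = pz z} ->
  {in S', forall t, \sum_(z <- S) q z t = pw t} ->
  (forall z t, ~~ r z t -> q z t = 0) ->
  (forall z, count (r z) S' <= L)%N ->
  \sum_(z <- S) pz z <= 1 ->
  shannon S' pw <= shannon S pz + L%:R.
Proof.
move=> q0 pz0 qz qt qr rL p1.
have q_le_pz z t : z \in S -> t \in S' -> q z t <= pz z.
  move=> zS tS'; rewrite -(qz _ zS) (big_rem t)//= lerDl.
  by apply: sumr_ge0 => *; exact: q0.
have q_le_pw z t : z \in S -> t \in S' -> q z t <= pw t.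
  move=> zS tS'; rewrite -(qt _ tS') (big_rem z)//= lerDl.
  by apply: sumr_ge0 => *; exact: q0.
have HW : shannon S' pw = \sum_(z <- S) \sum_(t <- S') - (q z t * ln (pw t)).
  rewrite exchange_big; apply: eq_big_seq => t tS'.
  by rewrite sumrN -mulr_suml qt.
have HZ : shannon S pz = \sum_(z <- S) \sum_(t <- S') - (q z t * ln (pz z)).
  by apply: eq_big_seq => z zS; rewrite sumrN -mulr_suml qz.
rewrite -lerBlDl HW HZ -sumrB.
apply: (@le_trans _ _ (\sum_(z <- S) pz z * L%:R)); last first.
  by rewrite -mulr_suml ler_piMl.
rewrite big_seq [leRHS]big_seq; apply: ler_sum => z zS.
apply: (@le_trans _ _ (\sum_(t <- S' | r z t) pz z)); last first.
  rewrite big_const_seq iter_addr_0 -[leLHS]mulr_natr ler_wpM2l//.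
  by rewrite ler_nat.
rewrite -sumrB [leRHS]big_mkcond [leLHS]big_seq [leRHS]big_seq.
apply: ler_sum => t tS'; case: ifPn => [_|/qr ->]; last by rewrite !mul0r subrr.
have := q0 z t; rewrite le_eqVlt => /predU1P[<-|qzt0].
  by rewrite !mul0r subrr.
have Pz := lt_le_trans qzt0 (q_le_pz _ _ zS tS').
have Pw := lt_le_trans qzt0 (q_le_pw _ _ zS tS').
rewrite opprK addrC -mulrBr -ln_div ?posrE//.
apply: (@le_trans _ _ (q z t * (pz z / pw t))).
  by rewrite ler_wpM2l// ltW// ln_sublinear ?divr_gt0.
rewrite mulrCA ger_pMr// ler_pdivrMr// mul1r.
exact: q_le_pw.
Qed.

End finite_entropy.

(** * Functions of a countable-valued variable *)

Section countable_valued.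
Context d (T : measurableType d) (R : realType).
Context (mu : {measure set T -> \bar R}).
Context (C : countType) (X : T -> C).
Hypothesis mX : forall c, measurable (X @^-1` [set c]).

Let F (k : nat) : set T := [set x | pickle (X x) = k].

Let mF k : measurable (F k).
Proof.
case E : (@unpickle C k) => [c|].
  have [ck|ck] := eqVneq (pickle c) k.
    rewrite (_ : F k = X @^-1` [set c]) //; apply/seteqP; split => x.
      by rewrite /F /= -ck => /(pcan_inj (@pickleK C)).
    by rewrite /F/= => ->.
  rewrite (_ : F k = set0)//; apply/seteqP; split => x //=.
  rewrite /F/= => xk; move: E ck; rewrite -xk pickleK => -[<-].
  by rewrite eqxx.
rewrite (_ : F k = set0)//; apply/seteqP; split => x //=.
by rewrite /F/= => xk; move: E; rewrite -xk pickleK.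
Qed.

Let bigcupF : \bigcup_k F k = setT.
Proof. by apply/seteqP; split => // x _; exists (pickle (X x)). Qed.

Let trivF : trivIset setT F.
Proof. by move=> i j _ _ [x [<- <-]]. Qed.

Let F_case k : F k = set0 \/ exists c, F k = X @^-1` [set c].
Proof.
have [->|/set0P[x xk]] := eqVneq (F k) set0; first by left.
right; exists (X x); apply/seteqP; split => y; rewrite /F/=.
  by rewrite -xk => /(pcan_inj (@pickleK C)).
by move=> ->.
Qed.

Lemma measurable_cut (A : set T) :
  (forall c, measurable (A `&` X @^-1` [set c])) -> measurable A.
Proof.
move=> mA; rewrite -[A]setIT -bigcupF setI_bigcupr.
apply: bigcupT_measurable => k.
have [->|[c ->//]] := F_case k.
by rewrite setI0; exact: measurable0.
Qed.

Lemma measurable_fiberwise (A : set T) :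
  (forall x y, X x = X y -> A x -> A y) -> measurable A.
Proof.
move=> XA; apply: measurable_cut => c.
have [->|/set0P[x [Ax xc]]] := eqVneq (A `&` X @^-1` [set c]) set0.
  exact: measurable0.
by rewrite setIidr// => y yc; apply: XA Ax; rewrite xc yc.
Qed.

Lemma measurable_fun_fiberwise d' (T' : measurableType d') (g : T -> T') :
  (forall x y, X x = X y -> g x = g y) -> measurable_fun setT g.
Proof.
move=> Xg _ B mB; rewrite setTI; apply: measurable_fiberwise => x y xy /=.
by rewrite (Xg _ _ xy).
Qed.

Lemma negligible_fiberwise (A : set T) :
  (forall c, mu.-negligible (A `&` X @^-1` [set c])) -> mu.-negligible A.
Proof.
move=> A0; rewrite -[A]setIT -bigcupF setI_bigcupr.
apply: negligible_bigcup => k.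
have [->|[c ->//]] := F_case k.
by rewrite setI0; exact: negligible_set0.
Qed.

Local Open Scope ereal_scope.

(** The tower property in the form needed: since [g] is constant on the fibers of
    [X], a bound [K] on the fiber averages of [u] can be pulled out of the
    integral. *)
Lemma tower_le (g u : T -> R) (K : R) :
  (0 <= K)%R -> (forall x, 0 <= g x)%R -> (forall x, 0 <= u x)%R ->
  (forall x y, X x = X y -> g x = g y) ->
  measurable_fun setT u ->
  (forall c, \int[mu]_(x in X @^-1` [set c]) (u x)%:E <=
             K%:E * mu (X @^-1` [set c])) ->
  \int[mu]_x (g x * u x)%:E <= K%:E * \int[mu]_x (g x)%:E.
Proof.
move=> K0 g0 u0 Xg mu_ uK; have mg := measurable_fun_fiberwise Xg.
have mg' : measurable_fun setT (fun x => (g x)%:E) by exact/measurable_EFinP.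
have mu' : measurable_fun setT (fun x => (u x)%:E) by exact/measurable_EFinP.
rewrite -ge0_integralZl//; last by move=> x _; rewrite lee_fin.
rewrite -bigcupF !ge0_integral_bigcup//=.
- apply: lee_nneseries => [k _ _|k _].
    by apply: integral_ge0 => x _; rewrite lee_fin mulr_ge0.
  have [->|[c ->]] := F_case k; first by rewrite !integral_set0.
  have [->|/set0P[x xc]] := eqVneq (X @^-1` [set c]) set0.
    by rewrite !integral_set0.
  have gE y : X y = c -> g y = g x by move=> yc; apply: Xg; rewrite yc xc.
  rewrite (eq_integral (fun y => (g x)%:E * (u y)%:E)); last first.
    by move=> y /set_mem/= yc; rewrite gE.
  rewrite [leRHS](eq_integral (cst (K * g x)%:E)); last first.
    by move=> y /set_mem/= yc; rewrite gE// EFinM.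
  have mu_c : measurable_fun (X @^-1` [set c]) (fun y => (u y)%:E).
    exact: measurable_funTS.
  have u0c y : (X @^-1` [set c]) y -> 0 <= (u y)%:E by rewrite lee_fin.
  rewrite integral_cst// ge0_integralZl ?lee_fin//.
  by rewrite EFinM muleAC [leRHS]muleC lee_wpmul2l ?lee_fin.
- rewrite bigcupF; apply: measurable_funeM => //.
- by move=> x _; rewrite -EFinM lee_fin mulr_ge0.
- rewrite bigcupF; apply/measurable_EFinP; exact: measurable_funM.
- by move=> x _; rewrite lee_fin mulr_ge0.
Qed.

Lemma integral_finite_valued (Q : set T) (S : seq C) (v : C -> R) :
  measurable Q -> uniq S -> (forall x, Q x -> X x \in S) ->
  (forall z, 0 <= v z)%R ->
  \int[mu]_(x in Q) (v (X x))%:E =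
  \sum_(z <- S) (v z)%:E * mu (Q `&` X @^-1` [set z]).
Proof.
move=> mQ uS QS v0.
have mI z : measurable (Q `&` X @^-1` [set z]) by exact: measurableI.
transitivity (\int[mu]_(x in Q)
    \sum_(z <- S) ((v z)%:E * (\1_(X @^-1` [set z]) x)%:E)).
  apply: eq_integral => x /set_mem Qx.
  rewrite (big_rem (X x)) ?QS//= indicE mem_set// mule1 big_seq big1 ?adde0//.
  move=> z; rewrite mem_rem_uniq// inE => /andP[zx _].
  rewrite indicE memNset ?mule0//=; move/eqP: zx => zx /esym xz.
  by apply: zx.
rewrite ge0_integral_sum//=; last 2 first.
- move=> z; apply: measurable_funeM; apply/measurable_EFinP.
  by apply: measurable_funTS; exact: measurable_indic.
- by move=> z x _; rewrite -EFinM lee_fin mulr_ge0.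
apply: eq_bigr => z _.
have mz : measurable_fun Q (fun x => (\1_(X @^-1` [set z]) x : R)%:E).
  apply/measurable_EFinP.
  by apply: measurable_funTS; exact: measurable_indic.
have z0 x : Q x -> 0 <= (\1_(X @^-1` [set z]) x : R)%:E by rewrite lee_fin.
rewrite ge0_integralZl ?lee_fin//.
by rewrite integral_indic// setIC.
Qed.

Lemma sum_fibers (Q : set T) (S : seq C) :
  measurable Q -> uniq S -> (forall x, Q x -> X x \in S) ->
  \sum_(z <- S) mu (Q `&` X @^-1` [set z]) = mu Q.
Proof.
move=> mQ uS QS.
rewrite -[RHS]mul1e -integral_cst//.
rewrite (@integral_finite_valued _ S (fun=> 1%R))//.
by apply: eq_bigr => z _; rewrite mul1e.
Qed.

End countable_valued.

Section integral_bounds.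
Context d (T : measurableType d) (R : realType).
Context (mu : {measure set T -> \bar R}).
Local Open Scope ereal_scope.

Lemma markov_set (g : T -> R) (A : set T) (c : R) : measurable A ->
  (0 <= c)%R -> (forall x, 0 <= g x)%R -> measurable_fun setT g ->
  (forall x, A x -> c <= g x)%R -> c%:E * mu A <= \int[mu]_x (g x)%:E.
Proof.
move=> mA c0 g0 mg Ag.
have mg' : measurable_fun setT (fun x => (g x)%:E) by exact/measurable_EFinP.
apply: (@le_trans _ _ (\int[mu]_(x in A) (g x)%:E)).
  rewrite -integral_cst//; apply: ge0_le_integral => //.
  exact: measurable_funTS.
by apply: ge0_subset_integral => // x _; rewrite lee_fin.
Qed.

Import HBNNSimple.

(** Immediate from the definition of the integral as a supremum over simple
    functions.  The smaller function will be built on the measure of a moving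
    ball. *)
Lemma ge0_le_integralT (f1 f2 : T -> \bar R) : (forall x, 0 <= f1 x) ->
  (forall x, f1 x <= f2 x) -> \int[mu]_x f1 x <= \int[mu]_x f2 x.
Proof.
move=> f10 f12; rewrite !ge0_integralTE//; last first.
  by move=> x; exact: le_trans (f12 x).
apply: ereal_sup_le => _ [h hf1 <-].
exists h => // x.
by rewrite (le_trans (hf1 x)).
Qed.

End integral_bounds.

(** * Information along a tree of cells *)

Lemma nneseries_geometric_lty (R : realType) (q : R) : 0 <= q < 1 ->
  (\sum_(n <oo) (q ^+ n)%:E < +oo)%E.
Proof.
move=> /andP[q0 q1].
rewrite (_ : (fun n => _) = EFin \o series (geometric 1 q)); last first.
  apply/funext => n /=; rewrite /series/= sumEFin.
  by congr EFin; apply: eq_bigr => i _; rewrite mul1r.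
rewrite EFin_lim ?ltry//.
by apply: is_cvg_geometric_series; rewrite ger0_norm.
Qed.

(** [X n] is the [n]-th level of a tree of cells, [Z n] a digit that can be read
    off at level [n.+1], and [p n c z] the conditional probability of the digit
    [z] in the cell [c].  In the application the digits do not determine the
    cells. *)
Section tree_process.
Context d (T : measurableType d) (R : realType) (mu : probability T R).
Context (C D : countType) (X : nat -> T -> C) (Z : nat -> T -> D).
Context (p : nat -> C -> D -> R) (S : seq D).
Hypothesis mX : forall n c, measurable (X n @^-1` [set c]).
Hypothesis X_refines : forall n x y, X n.+1 x = X n.+1 y -> X n x = X n y.
Hypothesis XZ : forall n x y, X n.+1 x = X n.+1 y -> Z n x = Z n y.
Hypothesis uS : uniq S.
Hypothesis ZS : forall n x, Z n x \in S.
Hypothesis p01 : forall n c z, 0 <= p n c z <= 1.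
Hypothesis pS : forall n c, \sum_(z <- S) p n c z <= 1.
Hypothesis pE : forall n c z,
  (mu (X n @^-1` [set c] `&` Z n @^-1` [set z]) =
   (p n c z)%:E * mu (X n @^-1` [set c]))%E.

Let p_ge0 n c z : 0 <= p n c z. Proof. by have /andP[] := p01 n c z. Qed.

Let X_le m n x y : (m <= n)%N -> X n x = X n y -> X m x = X m y.
Proof.
move=> /subnK <-; elim: (n - m)%N => [//|k ih] xy.
by apply: ih; apply: X_refines.
Qed.

Let mZ n z : measurable (Z n @^-1` [set z]).
Proof.
by apply: (measurable_fiberwise (mX n.+1)) => x y /XZ/= ->.
Qed.

Let Z_le m n x y : (m < n)%N -> X n x = X n y -> Z m x = Z m y.
Proof. by move=> mn /(X_le mn) /XZ. Qed.

Definition info n x : R := - ln (p n (X n x) (Z n x)).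

Definition mean_info n c : R := shannon S (p n c).

Let info_eq N n x y : (n < N.+1)%N -> X N.+1 x = X N.+1 y -> info n x = info n y.
Proof.
move=> nN xy; rewrite /info.
by rewrite (Z_le nN xy) (X_le _ xy)// ltnW.
Qed.

Let sum_info_eq N x y : X N.+1 x = X N.+1 y ->
  \sum_(1 <= n < N.+1) info n x = \sum_(1 <= n < N.+1) info n y.
Proof.
move=> xy; apply: eq_big_nat => n /andP[_ nN]; exact: info_eq xy.
Qed.

Lemma measurable_sum_info_ge N (a : R) :
  measurable [set x | a <= \sum_(1 <= n < N.+1) info n x].
Proof.
by apply: (measurable_fiberwise (mX N.+1)) => x y /sum_info_eq/= ->.
Qed.

Local Open Scope ereal_scope.

(** The product is a supermartingale up to the factor [K] per level: conditionally
    on the cell of level [n], the factor [v n] has mean at most [K]. *)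
Lemma integral_prod_le (v : nat -> C -> D -> R) (K : R) (N : nat) :
  (0 <= K)%R -> (forall n c z, 0 <= v n c z)%R ->
  (forall n c, \sum_(z <- S) v n c z * p n c z <= K)%R ->
  \int[mu]_x (\prod_(1 <= n < N.+1) v n (X n x) (Z n x))%:E <= (K ^+ N)%:E.
Proof.
move=> K0 v0 vK; elim: N => [|N ih].
  under eq_integral do rewrite big_geq//.
  by rewrite (integral_cst mu measurableT) mul1e [leLHS]probability_setT.
under eq_integral do rewrite big_nat_recr//=.
rewrite exprS EFinM.
apply: (@le_trans _ _ (K%:E *
    \int[mu]_x (\prod_(1 <= n < N.+1) v n (X n x) (Z n x))%:E)); last first.
  by rewrite lee_wpmul2l// lee_fin.
apply: (tower_le (mX N.+1)) => //.
- by move=> x; apply: prodr_ge0.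
- move=> x y xy; apply: eq_big_nat => n /andP[_ nN].
  by rewrite (Z_le nN xy) (X_le _ xy)// ltnW.
- apply: (measurable_fun_fiberwise (mX N.+2)) => x y xy.
  by rewrite (Z_le _ xy)// (X_le _ xy).
move=> c; rewrite (eq_integral (fun x => (v N.+1 c (Z N.+1 x))%:E)); last first.
  by move=> x /set_mem/= ->.
rewrite (integral_finite_valued _ (mZ N.+1) _ uS)//.
under eq_bigr => z _ do rewrite [X in _ * X]pE muleA -EFinM.
rewrite -ge0_sume_distrl; last first.
  by move=> z _; rewrite lee_fin mulr_ge0.
by rewrite lee_wpmul2r// sumEFin lee_fin.
Qed.

Lemma measurable_constrained (S' : nat -> C -> seq D) (N : nat) (a : R) :
  measurable [set x | (forall n, (1 <= n <= N)%N -> Z n x \in S' n (X n x)) /\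
                      (a <= \sum_(1 <= n < N.+1) info n x)%R].
Proof.
apply: (measurable_fiberwise (mX N.+1)) => x y xy [xS xN].
split; last by rewrite -(sum_info_eq xy).
move=> n n1N; have /andP[_ nN] := n1N.
by rewrite -(Z_le _ xy)// -(X_le _ xy) ?xS// ltnW.
Qed.

(** Exponential Markov inequality for the product of the
    [\1_(Z n \in S' n) * expR (info n)], whose factors have conditional mean at
    most [L].  A constraint on each digit, rather than a prescribed digit, costs
    only the factor [L] per level. *)
Lemma constrained_info_le (S' : nat -> C -> seq D) (L N : nat) (beta : R) :
  (forall n c, size (S' n c) <= L)%N ->
  mu [set x | (forall n, (1 <= n <= N)%N -> Z n x \in S' n (X n x)) /\
              (beta * N%:R <= \sum_(1 <= n < N.+1) info n x)%R]
  <= (expR (- (beta * N%:R)) * L%:R ^+ N)%:E.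
Proof.
move=> SL; set A := [set x | _].
pose v n c z : R := ((z \in S' n c)%:R * expR (- ln (p n c z)))%R.
have v0 n c z : (0 <= v n c z)%R by rewrite mulr_ge0// expR_ge0.
have mA : measurable A by exact: measurable_constrained.
have vL n c : (\sum_(z <- S) v n c z * p n c z <= L%:R)%R.
  by rewrite (le_trans (sum_inv_prob_le _ (p_ge0 n c) uS))// ler_nat.
have vA x : A x ->
    (expR (beta * N%:R) <= \prod_(1 <= n < N.+1) v n (X n x) (Z n x))%R.
  move=> [xS xN]; rewrite (eq_big_nat _ _ (F2 := fun n => expR (info n x))).
    by rewrite -expR_sum ler_expR.
  by move=> n n1N; rewrite /v xS// mul1r.
have mv : measurable_fun setT
    (fun x => \prod_(1 <= n < N.+1) v n (X n x) (Z n x))%R.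
  apply: (measurable_fun_fiberwise (mX N.+1)) => x y xy.
  apply: eq_big_nat => n /andP[_ nN].
  by rewrite (Z_le nN xy) (X_le _ xy)// ltnW.
have := le_trans (markov_set mu mA (expR_ge0 _) _ mv vA)
  (integral_prod_le N (ler0n _ _) v0 vL).
have -> : mu A = (expR (- (beta * N%:R)))%:E * ((expR (beta * N%:R))%:E * mu A).
  by rewrite muleA -EFinM -expRD addNr expR0 mul1e.
move=> h; rewrite EFinM lee_wpmul2l ?lee_fin ?expR_ge0// h//.
by move=> x; apply: prodr_ge0.
Qed.

(** Chernoff bound.  Small [l] makes the exponent negative, so that the measures
    are summable in [N]. *)
Lemma info_deviation_le (l : R) (N : nat) : (0 <= l)%R ->
  mu [set x | (N%:R <= \sum_(1 <= n < N.+1)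
                (mean_info n (X n x) - info n x))%R]
  <= ((expR (4 * (size S)%:R * l ^+ 2 - l)) ^+ N)%:E.
Proof.
move=> l0; set A := [set x | _].
pose v n c z : R := expR (l * (mean_info n c + ln (p n c z))).
have v0 n c z : (0 <= v n c z)%R by exact: expR_ge0.
have sumE N' x y : X N'.+1 x = X N'.+1 y ->
    (\sum_(1 <= n < N'.+1) (mean_info n (X n x) - info n x) =
     \sum_(1 <= n < N'.+1) (mean_info n (X n y) - info n y))%R.
  move=> xy; apply: eq_big_nat => n /andP[_ nN].
  by rewrite (info_eq nN xy) (X_le _ xy)// ltnW.
have mA : measurable A.
  by apply: (measurable_fiberwise (mX N.+1)) => x y xy; rewrite /A/= (sumE _ _ _ xy).
have vK n c : (\sum_(z <- S) v n c z * p n c z <=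
               expR (4 * (size S)%:R * l ^+ 2))%R.
  rewrite (_ : \sum_(z <- S) _ = expR (l * mean_info n c) *
      \sum_(z <- S) p n c z * expR (l * ln (p n c z)))%R; last first.
    rewrite mulr_sumr; apply: eq_bigr => z _.
    by rewrite /v mulrDr expRD; ring.
  have := sum_expR_ln_le l0 (p01 n c) (pS n c).
  rewrite expRD -/(mean_info n c) expRN ler_pdivlMr ?expR_gt0// => h.
  by rewrite mulrC.
have vA x : A x ->
    (expR (l * N%:R) <= \prod_(1 <= n < N.+1) v n (X n x) (Z n x))%R.
  move=> Ax; rewrite /v -expR_sum ler_expR -mulr_sumr ler_wpM2l//.
  by apply: (le_trans Ax); apply: ler_sum => n _; rewrite /info opprK.
have mv : measurable_fun setT
    (fun x => \prod_(1 <= n < N.+1) v n (X n x) (Z n x))%R.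
  apply: (measurable_fun_fiberwise (mX N.+1)) => x y xy.
  apply: eq_big_nat => n /andP[_ nN].
  by rewrite (Z_le nN xy) (X_le _ xy)// ltnW.
have := le_trans (markov_set mu mA (expR_ge0 _) _ mv vA)
  (integral_prod_le N (expR_ge0 _) v0 vK).
have -> : mu A = (expR (- (l * N%:R)))%:E * ((expR (l * N%:R))%:E * mu A).
  by rewrite muleA -EFinM -expRD addNr expR0 mul1e.
have -> : (expR (4 * (size S)%:R * l ^+ 2 - l) ^+ N =
    expR (- (l * N%:R)) * expR (4 * (size S)%:R * l ^+ 2) ^+ N)%R.
  by rewrite addrC expRD exprMn -(expRM_natr N (- l)) mulNr.
move=> h; rewrite EFinM lee_wpmul2l ?lee_fin ?expR_ge0// h//.
by move=> x; apply: prodr_ge0.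
Qed.

(** One-sided replacement for the law of large numbers: information falls short
    of its conditional mean by at most 1 per level.  A loss of 1 per level is
    affordable because it does not depend on the base. *)
Lemma ae_info_gt_mean_info : {ae mu, forall x, exists N0, forall N, (N0 <= N)%N ->
  (\sum_(1 <= n < N.+1) mean_info n (X n x) <
   \sum_(1 <= n < N.+1) info n x + N%:R)%R}.
Proof.
pose M : R := (size S).+1%:R.
(* The minimizer of [4 * M * l ^+ 2 - l], so that the Chernoff exponent is
   negative; the successor makes [M] positive. *)
pose l : R := ((8 * M)^-1)%R.
have M0 : (0 < M)%R by rewrite ltr0n.
have l0 : (0 < l)%R by rewrite invr_gt0 mulr_gt0.
have lM : (M * l = 8^-1)%R by rewrite /l invfM mulrCA divff ?mulr1// gt_eqF.
pose F (N : nat) := [set x | (N%:R <= \sum_(1 <= n < N.+1)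
                (mean_info n (X n x) - info n x))%R].
have mF N : measurable (F N).
  apply: (measurable_fiberwise (mX N.+1)) => x y xy.
  rewrite /F/= (eq_big_nat _ _ (F2 := fun n =>
      mean_info n (X n y) - info n y)%R)//.
  move=> n /andP[_ nN].
  by rewrite (info_eq nN xy) (X_le _ xy)// ltnW.
have F0 : mu (lim_sup_set F) = 0.
  apply: lim_sup_set_cvg0 => //.
  pose q := expR (4 * (size S)%:R * l ^+ 2 - l).
  have q01 : (0 <= q < 1)%R.
    rewrite expR_ge0 expR_lt1.
    have : ((size S)%:R * l <= M * l)%R by rewrite ler_wpM2r ?ler_nat// ltW.
    rewrite lM; nra.
  apply: le_lt_trans (nneseries_geometric_lty q01).
  apply: lee_nneseries => // n _; apply: info_deviation_le; exact: ltW.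
exists (lim_sup_set F); split => //.
  apply: bigcapT_measurable => n; apply: bigcup_measurable => k _; exact: mF.
move=> x /= nF n _; apply: contrapT => nFx; apply: nF; exists n => N nN.
rewrite -ltrBlDl -sumrB ltNge; apply/negP => FN.
by apply: nFx; exists N.
Qed.

End tree_process.

(** * Adic cells *)

Section floor_estimates.
Context (R : realType).

Lemma floor_dist_le (a b : R) (K : nat) : `|a - b| <= K%:R ->
  `|Num.floor a - Num.floor b| <= K%:Z.
Proof.
have le1 (s t : R) : s - t <= K%:R -> Num.floor s - Num.floor t <= K%:Z.
  move=> st; rewrite lerBlDr -ltzD1 floor_lt_int.
  have := floorD1_gt t; rewrite !rmorphD/= => h.
  by rewrite -pmulrn; lra.
rewrite ler_norml => /andP[ab1 ab2].
rewrite ler_norml lerNl opprB !le1//.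
by lra.
Qed.

Lemma floorM_inj (b : nat) (s t : R) : (0 < b)%N ->
  Num.floor (b%:R * s) = Num.floor (b%:R * t) -> Num.floor s = Num.floor t.
Proof.
move=> b0 bst; have b0' : 0 < b%:R :> R by rewrite ltr0n.
have le1 (u v : R) : Num.floor (b%:R * u) = Num.floor (b%:R * v) ->
    Num.floor u <= Num.floor v.
  move=> uv; rewrite floor_ge_int -(ler_pM2l b0').
  rewrite (_ : b%:R * (Num.floor u)%:~R = (b%:Z * Num.floor u)%:~R); last first.
    by rewrite intrM.
  rewrite -floor_ge_int -uv floor_ge_int intrM ler_pM2l//.
  exact: floor_le.
by apply/eqP; rewrite eq_le !le1.
Qed.

End floor_estimates.

(** Integer vectors with entries in [-m, m].  Only two things matter: it is a
    finite list, and its length is a function of [k] and [m]. *)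
Definition int_box (k m : nat) : seq 'rV[int]_k :=
  [seq \row_i ((g i : nat)%:Z - m%:Z) | g : {ffun 'I_k -> 'I_(m.*2.+1)}].

Lemma mem_int_box (k m : nat) (v : 'rV[int]_k) :
  (forall i, `|v 0 i| <= m%:Z) -> v \in int_box k m.
Proof.
move=> vm; apply/mapP.
exists [ffun i => inord (absz (v 0 i + m%:Z))]; rewrite ?mem_enum//.
apply/rowP => i; rewrite !mxE ffunE.
have := vm i; rewrite ler_norml => /andP[vm1 vm2].
have h : (0 <= v 0 i + m%:Z) by rewrite addrC -lerBlDl sub0r.
rewrite inordK ?gez0_abs ?addrK//.
rewrite ltnS -lez_nat gez0_abs// -addnn PoszD.
by rewrite lerD2r.
Qed.

Section cells.
Context (R : realType) (k : nat).
Implicit Types (p : nat) (x y : 'rV[R]_k) (j : 'rV[int]_k).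

Lemma ler_norm_rowP x (e : R) : 0 <= e ->
  reflect (forall i, `|x 0 i| <= e) (`|x| <= e).
Proof.
move=> e0; apply: (iffP idP) => [xe i|xe].
  by apply: le_trans xe; rewrite [leRHS]/Num.norm/= mx_normrE;
     apply/bigmax_geP; right => /=; exists (0, i).
rewrite [leLHS]/Num.norm/= mx_normrE; apply/bigmax_leP; split => // -[i j] _ /=.
by rewrite ord1.
Qed.

Lemma cellE p j : (0 < p)%N -> cell p j = @cell_index R k p @^-1` [set j].
Proof.
move=> p0; have p0' : 0 < p%:R :> R by rewrite ltr0n.
apply/seteqP; split=> [x jx|x <- i].
  apply/rowP => i; rewrite mxE; apply/floor_def; rewrite mulrC.
  by have := jx i; rewrite in_itv/= ler_pdivrMr// ltr_pdivlMr// intrD.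
rewrite mxE in_itv/= ler_pdivrMr// ltr_pdivlMr// mulrC.
by rewrite -[X in _ + X](mulr1z (1 : R)) -intrD floor_itv.
Qed.

Lemma measurable_cell_index p j : (0 < p)%N ->
  measurable (@cell_index R k p @^-1` [set j]).
Proof. by move=> p0; rewrite -cellE//; exact: measurable_cell. Qed.

Lemma cell_index_dist p x y (K : nat) :
  (forall i, `|p%:R * x 0 i - p%:R * y 0 i| <= K%:R) ->
  cell_index p x - cell_index p y \in int_box k K.
Proof.
by move=> xy; apply: mem_int_box => i; rewrite !mxE; exact: floor_dist_le.
Qed.

Lemma cell_index_refines b n x y : (0 < b)%N ->
  cell_index (b ^ n.+1) x = cell_index (b ^ n.+1) y ->
  cell_index (b ^ n) x = cell_index (b ^ n) y.
Proof.
move=> b0 /rowP xy; apply/rowP => i; have := xy i.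
by rewrite !mxE expnS natrM -!mulrA; exact: floorM_inj.
Qed.

(** Cells of side [p^-1] sit in balls of radius [p^-1] for the sup norm, which is
    why the ball entropy is dominated by the entropy of the partition. *)
Lemma cell_subset_closed_ball p x y : (0 < p)%N ->
  cell_index p y = cell_index p x -> closed_ball x (p%:R^-1 : R) y.
Proof.
move=> p0 /rowP xy; have p0' : 0 < p%:R :> R by rewrite ltr0n.
rewrite closed_ballE ?invr_gt0// /closed_ball_/=.
apply/ler_norm_rowP => [|i]; first by rewrite invr_ge0 ltW.
rewrite !mxE -(ler_pM2l p0') divff ?gt_eqF//.
rewrite -[X in X * _](gtr0_norm p0') -normrM mulrBr.
have := xy i; rewrite !mxE => fxy.
have /andP[x1 x2] := floor_itv (p%:R * x 0 i).
have /andP[y1 y2] := floor_itv (p%:R * y 0 i).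
move: x1 x2 y1 y2; rewrite fxy !rmorphD/= => x1 x2 y1 y2.
rewrite ler_norml; apply/andP; split; lra.
Qed.

Lemma closed_ball_measurable x (r : R) : measurable (closed_ball x r).
Proof.
rewrite -[X in measurable X]setCK; apply: measurableC.
by apply: open_measurable_mx; apply: closed_openC; exact: closed_ball_closed.
Qed.

(** The lowest vertex of the cell of [x]; unlike [x] it is a function of the
    cell. *)
Definition corner p x : 'rV[R]_k := p%:R^-1 *: map_mx intr (cell_index p x).

Lemma corner_dist p x i : (0 < p)%N ->
  0 <= p%:R * (x 0 i - corner p x 0 i) <= 1.
Proof.
move=> p0; rewrite mulrBr !mxE mulVKf ?pnatr_eq0 -?lt0n//.
have /andP[x1 x2] := floor_itv (p%:R * x 0 i).
move: x2; rewrite rmorphD/= => x2.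
by apply/andP; split; lra.
Qed.

Lemma cell_index_corner p x : (0 < p)%N ->
  cell_index p (corner p x) = cell_index p x.
Proof.
move=> p0; apply/rowP => i; rewrite !mxE mulVKf ?pnatr_eq0 -?lt0n//.
exact: intrKfloor.
Qed.

Lemma rescale_itv p x i : 0 <= (rescale p (cell_index p x) x) 0 i <= 1.
Proof.
rewrite !mxE; have /andP[x1 x2] := floor_itv (p%:R * x 0 i).
move: x2; rewrite rmorphD/= => x2.
by apply/andP; split; lra.
Qed.

End cells.

(** * Projecting the adic cells *)

Section projected_cells.
Context (R : realType) (d k : nat) (P : 'M[R]_d) (E : 'M[R]_(k, d)).
Hypothesis hP : orthogonal_projection k P.
Hypothesis hE : orthonormal_basis P E.
Local Notation f := (proj_coord P E).
Implicit Types (x : 'rV[R]_d) (n b : nat).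

(** An orthonormal basis [E] of the range of [P] satisfies [E *m P = E], so that
    the projection disappears from its own coordinates. *)
Lemma proj_coordE x : f x = x *m E^T.
Proof.
have [PP PT _] := hP; have [_ /andP[/submxP[D ED] _]] := hE.
have EP : E *m P = E by rewrite ED -mulmxA PP.
by rewrite /proj_coord -mulmxA -{1}PT -trmx_mul EP.
Qed.

Lemma proj_coordB x y : f (x - y) = f x - f y.
Proof. by rewrite /proj_coord !mulmxBl. Qed.

Lemma proj_coordZ (a : R) x : f (a *: x) = a *: f x.
Proof. by rewrite /proj_coord -!scalemxAl. Qed.

Lemma orthonormal_entry_le1 i j : `|E i j| <= 1.
Proof.
have [EE _] := hE; have := congr1 (fun A : 'M[R]_k => A i i) EE.
rewrite !mxE eqxx (bigD1 j)//= !mxE => h.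
have : 0 <= \sum_(l < d | l != j) E i l * E^T l i.
  by apply: sumr_ge0 => l _; rewrite mxE -expr2 sqr_ge0.
have := normr_ge0 (E i j); have := real_normK (num_real (E i j)).
by rewrite !expr2; nra.
Qed.

(** The constant [d] is crude but depends on the dimension only, as is required of
    the constant of the theorem. *)
Lemma proj_coord_le x (c : R) i : (forall j, `|x 0 j| <= c) ->
  `|f x 0 i| <= d%:R * c.
Proof.
move=> xc; rewrite proj_coordE mxE (le_trans (ler_norm_sum _ _ _))//.
rewrite -[X in X%:R * _](card_ord d) mulr_natl -sumr_const.
apply: ler_sum => j _; rewrite normrM -[leRHS]mulr1 ler_pM// mxE.
exact: orthonormal_entry_le1.
Qed.

(** The image of [x], seen after the homothety that blows up its cell of level [n]
    to the unit cube. *)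
Definition local_image b n x : 'rV[R]_k :=
  f (rescale (b ^ n) (cell_index (b ^ n) x) x).

(** The same for the corner of the cell of level [n.+1] instead of [x], which
    makes it a function of that cell. *)
Definition child_image b n x : 'rV[R]_k :=
  f (rescale (b ^ n) (cell_index (b ^ n) x) (corner (b ^ n.+1) x)).

Definition fine_digit b n x := cell_index b (local_image b n x).

Definition digit b n x := cell_index b (child_image b n x).

Lemma digit_refines b n x y : (0 < b)%N ->
  cell_index (b ^ n.+1) x = cell_index (b ^ n.+1) y ->
  digit b n x = digit b n y.
Proof.
move=> b0 xy; rewrite /digit /child_image /corner.
by rewrite xy (cell_index_refines b0 xy).
Qed.

(** Moving from [x] to the corner of its cell of level [n.+1] moves the image by
    at most [d] times the side of the cells that define the digits. *)
Lemma fine_digit_near b n x : (0 < b)%N ->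
  fine_digit b n x - digit b n x \in int_box k d.
Proof.
move=> b0; apply: cell_index_dist => i.
have -> : b%:R * local_image b n x 0 i - b%:R * child_image b n x 0 i =
          f ((b ^ n.+1)%:R *: (x - corner (b ^ n.+1) x)) 0 i.
  rewrite /local_image /child_image /rescale expnSr natrM.
  rewrite !(proj_coordB, proj_coordZ).
  by rewrite !mxE; ring.
rewrite -[leRHS]mulr1; apply: proj_coord_le => j.
have bn0 : (0 < b ^ n.+1)%N by rewrite expn_gt0 b0.
have /andP[h0 h1] := corner_dist x j bn0.
by move: h0 h1; rewrite !mxE => h0 h1; rewrite ger0_norm.
Qed.

Lemma child_image_le b n x i : (0 < b)%N -> `|child_image b n x 0 i| <= d%:R.
Proof.
move=> b0; rewrite -[leRHS]mulr1; apply: proj_coord_le => j.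
have bn0 : (0 < b ^ n.+1)%N by rewrite expn_gt0 b0.
have <- : cell_index (b ^ n) (corner (b ^ n.+1) x) = cell_index (b ^ n) x.
  by apply: cell_index_refines => //; exact: cell_index_corner.
have /andP[h0 h1] := rescale_itv (b ^ n) (corner (b ^ n.+1) x) j.
by rewrite ger0_norm.
Qed.

Lemma local_image_le b n x i : `|local_image b n x 0 i| <= d%:R.
Proof.
rewrite -[leRHS]mulr1; apply: proj_coord_le => j.
have /andP[h0 h1] := rescale_itv (b ^ n) x j.
by rewrite ger0_norm.
Qed.

Let cell_index0 b : cell_index b (0 : 'rV[R]_k) = 0.
Proof. by apply/rowP => i; rewrite !mxE mulr0 floor0. Qed.

Let bounded_cell_index b (y : 'rV[R]_k) : (forall i, `|y 0 i| <= d%:R) ->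
  cell_index b y \in int_box k (b * d).
Proof.
move=> yd; rewrite -[cell_index b y]subr0 -(cell_index0 b).
apply: cell_index_dist => i; rewrite mxE mulr0 subr0 normrM natrM.
by rewrite ger0_norm// ler_wpM2l.
Qed.

Lemma digit_bounded b n x : (0 < b)%N -> digit b n x \in int_box k (b * d).
Proof.
by move=> b0; apply: bounded_cell_index => i; exact: child_image_le.
Qed.

Lemma fine_digit_bounded b n x : fine_digit b n x \in int_box k (b * d).
Proof. by apply: bounded_cell_index => i; exact: local_image_le. Qed.

(** The digit that a point of the cell [c] of level [n] would have if it were
    projected to [y]. *)
Definition target_digit b n (y : 'rV[R]_k) (c : 'rV[int]_d) : 'rV[int]_k :=
  cell_index b ((b ^ n)%:R *: y - f (map_mx intr c)).

(** One unit for the distance from [f x] to [y], and [d] units for replacing [x]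
    by a corner. *)
Lemma digit_near_target b n N x (y : 'rV[R]_k) : (0 < b)%N -> (n <= N)%N ->
  `|f x - y| <= (b%:R ^- N.+1) ->
  digit b n x - target_digit b n y (cell_index (b ^ n) x) \in int_box k d.+1.
Proof.
move=> b0 nN xy; have b0' : 0 < b%:R :> R by rewrite ltr0n.
have b1 : 1 <= b%:R :> R by rewrite ler1n.
set c := cell_index _ _; apply: cell_index_dist => i.
have -> : b%:R * child_image b n x 0 i -
    b%:R * ((b ^ n)%:R *: y - f (map_mx intr c)) 0 i =
    (b ^ n.+1)%:R * (f x - y) 0 i -
    f ((b ^ n.+1)%:R *: (x - corner (b ^ n.+1) x)) 0 i.
  rewrite /child_image /rescale -/c expnSr natrM.
  rewrite !(proj_coordB, proj_coordZ).
  by rewrite !mxE; ring.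
rewrite -[leRHS]nat1r (le_trans (ler_normB _ _))// lerD//.
  have e0 : 0 <= b%:R ^- N.+1 :> R by rewrite invr_ge0 exprn_ge0// ltW.
  have /(ler_norm_rowP _ e0)/(_ i) h := xy.
  rewrite normrM ger0_norm// -[leRHS](@mulfV _ (b%:R ^+ N.+1)) ?expf_neq0 ?gt_eqF//.
  rewrite natrX; apply: ler_pM => //; exact: ler_weXn2l.
rewrite -[leRHS]mulr1; apply: proj_coord_le => j.
have bn0 : (0 < b ^ n.+1)%N by rewrite expn_gt0 b0.
have /andP[h0 h1] := corner_dist x j bn0.
by move: h0 h1; rewrite !mxE => h0 h1; rewrite ger0_norm.
Qed.

Lemma measurable_digit b n z : (0 < b)%N -> measurable (digit b n @^-1` [set z]).
Proof.
move=> b0; have bn0 : (0 < b ^ n.+1)%N by rewrite expn_gt0 b0.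
apply: (measurable_fiberwise (fun c => measurable_cell_index c bn0)).
by move=> x y /(digit_refines b0)/= ->.
Qed.

Lemma fine_digit_cut b n z c :
  fine_digit b n @^-1` [set z] `&` @cell_index R d (b ^ n) @^-1` [set c] =
  (rescale (b ^ n) c @^-1` (f @^-1` (@cell_index R k b @^-1` [set z]))) `&`
     @cell_index R d (b ^ n) @^-1` [set c].
Proof.
by apply/seteqP; split => x [/= + xc]; rewrite /fine_digit /local_image xc.
Qed.

(** The fine digit is not constant on cells of any level, so measurability is
    checked separately on each cell of level [n], where it is a cell index of a
    fixed affine image. *)
Lemma measurable_fine_digit b n z : (0 < b)%N ->
  measurable (fine_digit b n @^-1` [set z]).
Proof.
move=> b0; have bn0 : (0 < b ^ n)%N by rewrite expn_gt0 b0.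
apply: (@measurable_cut _ _ _ (@cell_index R d (b ^ n))) => c.
rewrite fine_digit_cut; apply: measurableI; last exact: measurable_cell_index.
rewrite -[X in measurable X]setTI; apply: measurable_rescale => //.
rewrite -[X in measurable X]setTI; apply: measurable_proj_coord => //.
exact: measurable_cell_index.
Qed.

End projected_cells.

(** * Entropy of the projected scenery *)

Section ball_entropy.
Context (R : realType) (k : nat) (nu : probability 'rV[R]_k R).
Local Open Scope ereal_scope.

(** The ball around [y] contains the cell of [y], so the entropy at scale [b^-1]
    is at most the integral of [- lne] of the mass of the cell.  The cells of mass
    0, where the integrand is infinite, form a null set. *)
Lemma entropy_le_shannon b (S : seq 'rV[int]_k) : (0 < b)%N -> uniq S ->
  (forall t, t \notin S -> nu (@cell_index R k b @^-1` [set t]) = 0) ->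
  entropy (b%:R^-1)%R nu <=
  (shannon S (fun t => fine (nu (@cell_index R k b @^-1` [set t]))))%:E.
Proof.
move=> b0 uS S0.
have mI t : measurable (@cell_index R k b @^-1` [set t]).
  exact: measurable_cell_index.
pose q t := nu (@cell_index R k b @^-1` [set t]).
have qfin t : q t \is a fin_num by exact: fin_num_measure.
have q1 t : q t <= 1 by exact: probability_le1.
have fq1 t : (fine (q t) <= 1)%R by rewrite -lee_fin fineK.
have Nlne_ge0 A : measurable A -> 0 <= - lne (nu A).
  by move=> mA; rewrite leeNr oppe0 lne_le0; exact: probability_le1.
pose G (y : 'rV[R]_k) := - lne (q (cell_index b y)).
have G0 y : 0 <= G y by exact: Nlne_ge0.
have GX x y : @cell_index R k b x = cell_index b y -> G x = G y.
  by rewrite /G => ->.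
have mG := measurable_fun_fiberwise mI GX.
apply: (@le_trans _ _ (\int[nu]_y G y)).
  pose B y := - lne (nu (closed_ball y (b%:R^-1)%R)).
  have B0 y : 0 <= B y by apply: Nlne_ge0; exact: closed_ball_measurable.
  rewrite /entropy (_ : (fun t => _) = (fun y => - B y)); last first.
    by apply/funext => y; rewrite oppeK.
  rewrite integral_ge0N// oppeK; apply: ge0_le_integralT => // y.
  rewrite leeN2 lee_lne ?in_itv/= ?measure_ge0 ?leey//.
  apply: le_measure; rewrite ?inE//; first exact: closed_ball_measurable.
  by move=> z /= zy; exact: cell_subset_closed_ball.
(* [lne 0 = -oo] whereas [ln 0 = 0]: off [N] the two logarithms agree. *)
pose N := [set y : 'rV[R]_k | q (cell_index b y) = 0].
have mN : measurable N.
  by apply: (measurable_fiberwise mI) => x y xy; rewrite /N/= xy.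
have N0 : nu N = 0.
  apply/negligibleP => //.
  apply: (@negligible_fiberwise _ _ _ _ _ (@cell_index R k b)) => c.
  have [qc|qc] := eqVneq (q c) 0.
    exact/(negligibleS (@subIsetr _ _ _))/negligibleP.
  rewrite (_ : _ `&` _ = set0); first exact: negligible_set0.
  apply/seteqP; split => // y [/= + yc].
  by rewrite /N/= yc => /eqP; rewrite (negbTE qc).
rewrite (ge0_negligible_integral mN measurableT _ _ N0)//.
rewrite (eq_integral (fun y => (- ln (fine (q (cell_index b y))))%:E)); last first.
  move=> y /set_mem[_ /= /eqP qy]; rewrite /G.
  have q0 : (0 < fine (q (cell_index b y)))%R.
    by rewrite fine_gt0// lt0e qy measure_ge0 ltey_eq qfin.
  by rewrite -[X in lne X]fineK// lne_EFin// EFinN.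
have SN y : ([set: 'rV[R]_k] `\` N) y -> cell_index b y \in S.
  by move=> [_]; apply: contra_notT => /S0.
have mTN : measurable ([set: 'rV[R]_k] `\` N) by exact: measurableD.
rewrite (integral_finite_valued nu mI mTN uS SN (v := fun t => - ln (fine (q t)))%R).
  rewrite /shannon -sumEFin; apply: lee_sum => t _.
  have -> : (- (fine (q t) * ln (fine (q t))))%:E =
            (- ln (fine (q t)))%:E * (fine (q t))%:E.
    by rewrite -EFinM mulNr mulrC.
  apply: lee_wpmul2l; first by rewrite lee_fin oppr_ge0 ln_le0.
  rewrite fineK//; apply: le_measure; rewrite ?inE//; first exact: measurableI.
by move=> t; rewrite oppr_ge0 ln_le0.
Qed.

End ball_entropy.

Section conditional.
Context (R : realType) (d k : nat) (mu : probability 'rV[R]_d R).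
Context (P : 'M[R]_d) (E : 'M[R]_(k, d)).
Hypothesis hP : orthogonal_projection k P.
Hypothesis hE : orthonormal_basis P E.
Context (b : nat) (b0 : (0 < b)%N).
Local Notation X n := (@cell_index R d (b ^ n)).
Local Notation Z := (digit P E b).
Local Notation W := (fine_digit P E b).
Local Open Scope ereal_scope.

Definition cond_measure n c : probability 'rV[R]_d R :=
  mnormalize (mrestr mu (measurable_cell (b ^ n) c)) mu.

Definition digits : seq 'rV[int]_k := undup (int_box k (b * d)).

Definition digit_prob n c z : R := fine (cond_measure n c (Z n @^-1` [set z])).

Let bn0 n : (0 < b ^ n)%N. Proof. by rewrite expn_gt0 b0. Qed.

Let mX n c : measurable (X n @^-1` [set c]).
Proof. exact: measurable_cell_index. Qed.

Let mZ n z : measurable (Z n @^-1` [set z]).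
Proof. exact: measurable_digit. Qed.

Let mW n z : measurable (W n @^-1` [set z]).
Proof. exact: measurable_fine_digit. Qed.

Lemma cond_measureE n c A : mu (X n @^-1` [set c]) != 0 ->
  cond_measure n c A =
  mu (A `&` X n @^-1` [set c]) * ((fine (mu (X n @^-1` [set c])))^-1)%:E.
Proof.
move=> Q0; have restrE B : mrestr mu (measurable_cell (b ^ n) c) B =
    mu (B `&` X n @^-1` [set c]) by rewrite /mrestr cellE.
rewrite /cond_measure /= /mnormalize /= !restrE setTI (negbTE Q0)/= ifF ?restrE//.
by apply/negbTE; rewrite -ltey -ge0_fin_numE// fin_num_measure.
Qed.

(** In a null cell both sides vanish, whatever the fallback value of the
    normalization. *)
Lemma mu_cell_digit n c z : mu (X n @^-1` [set c] `&` Z n @^-1` [set z]) =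
  (digit_prob n c z)%:E * mu (X n @^-1` [set c]).
Proof.
have [Q0|Q0] := eqVneq (mu (X n @^-1` [set c])) 0.
  rewrite Q0 mule0; apply/eqP; rewrite eq_le measure_ge0 andbT -Q0.
  by apply: le_measure; rewrite ?inE//; exact: measurableI.
rewrite /digit_prob fineK ?fin_num_measure// cond_measureE// setIC.
rewrite -muleA -{2}[mu (X n @^-1` [set c])]fineK ?fin_num_measure//.
rewrite -EFinM mulVf ?mule1// fine_eq0// fin_num_measure//.
Qed.

Lemma digit_prob_01 n c z : (0 <= digit_prob n c z <= 1)%R.
Proof.
rewrite fine_ge0//= -lee_fin fineK ?fin_num_measure//.
exact: probability_le1.
Qed.

Lemma mem_digits n x : Z n x \in digits.
Proof. by rewrite mem_undup; exact: digit_bounded. Qed.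

Lemma uniq_digits : uniq digits. Proof. exact: undup_uniq. Qed.

Lemma sum_digit_prob n c : (\sum_(z <- digits) digit_prob n c z <= 1)%R.
Proof.
rewrite -lee_fin -sumEFin.
rewrite (eq_bigr (fun z => cond_measure n c (setT `&` Z n @^-1` [set z]))).
  rewrite (sum_fibers (cond_measure n c) (mZ n) measurableT uniq_digits).
    by rewrite [leLHS]probability_setT.
  by move=> x _; exact: mem_digits.
by move=> z _; rewrite setTI fineK// fin_num_measure.
Qed.

(** The entropy of the projected scenery is at most that of the fine digit, and
    the fine digit differs from the digit by one of [size (int_box k d)]
    vectors. *)
Lemma entropy_scenery_le n x : mu (X n @^-1` [set X n x]) != 0 ->
  entropy (b%:R^-1)%R (distribution (scenery mu b x n) (proj_coord P E)) <=
  (mean_info digit_prob digits n (X n x) + (size (int_box k d))%:R)%:E.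
Proof.
set c := X n x => Q0.
set nu := distribution _ _.
have nuE t : nu (@cell_index R k b @^-1` [set t]) =
             cond_measure n c (W n @^-1` [set t]).
  by rewrite [RHS]cond_measureE// fine_digit_cut -cond_measureE.
have Wd y : W n y \in digits by rewrite mem_undup; exact: fine_digit_bounded.
have W0 t : t \notin digits -> nu (@cell_index R k b @^-1` [set t]) = 0.
  move=> tS; rewrite nuE (_ : _ @^-1` _ = set0) ?measure0//.
  by apply/seteqP; split => // y /= yt; move: tS; rewrite -yt Wd.
apply: (le_trans (entropy_le_shannon b0 uniq_digits W0)).
rewrite lee_fin /mean_info.
pose J z t := cond_measure n c (Z n @^-1` [set z] `&` W n @^-1` [set t]).
have Jfin z t : J z t \is a fin_num.
  by apply: fin_num_measure; exact: measurableI.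
apply: (@shannon_le_related _ _ _ digits digits
    (fun z t => t - z \in int_box k d)%R (fun z t => fine (J z t))).
- by move=> z t; apply: fine_ge0.
- by move=> z; have /andP[] := digit_prob_01 n c z.
- move=> z _; apply: EFin_inj; rewrite -sumEFin /digit_prob.
  under eq_bigr do rewrite fineK//.
  rewrite fineK ?fin_num_measure//.
  exact: (sum_fibers (cond_measure n c) (mW n) (mZ n z) uniq_digits).
- move=> t _; apply: EFin_inj; rewrite -sumEFin [Y in _ = (fine Y)%:E](nuE t).
  under eq_bigr do rewrite fineK// /J setIC.
  rewrite fineK ?fin_num_measure//.
  apply: (sum_fibers (cond_measure n c) (mZ n) (mW n t) uniq_digits).
  by move=> x' _; exact: mem_digits.
- move=> z t; apply: contraNeq => J0; apply: contrapT => ztn.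
  move/negP : J0; apply; rewrite /J (_ : _ `&` _ = set0) ?measure0//.
  apply/seteqP; split => // y [/= yz yt]; apply: ztn.
  by rewrite -yz -yt; exact: fine_digit_near.
- move=> z; rewrite -size_filter.
  apply: (@leq_trans (size [seq z + v | v <- int_box k d])%R); last first.
    by rewrite size_map.
  apply: uniq_leq_size; first by rewrite filter_uniq// uniq_digits.
  move=> t; rewrite mem_filter => /andP[tz _].
  by apply/mapP; exists (t - z)%R => //; rewrite addrC subrK.
- exact: sum_digit_prob.
Qed.

End conditional.

(** * The mass distribution principle *)

Section mass_distribution.
Context (R : realType) (k : nat) (rho : {measure set 'rV[R]_k -> \bar R}).
Implicit Types (A U V : set 'rV[R]_k) (s delta : R).
Local Open Scope ereal_scope.

Lemma diam_pow_ge0 s U : 0 <= diam_pow s U.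
Proof. by rewrite /diam_pow; case: ifPn => // _; exact: poweR_ge0. Qed.

(** Mass distribution principle.  The sets of a cover need not be measurable,
    hence the auxiliary [V]. *)
Lemma mass_distribution A s delta (K : R) : measurable A ->
  hausdorff_measure s A = 0 -> (0 < delta)%R -> (0 <= K)%R ->
  (forall U, diam U <= delta%:E -> exists V,
     [/\ measurable V, U `<=` V & rho V <= K%:E * diam_pow s U]) ->
  rho A = 0.
Proof.
move=> mA HA d0 K0 UV; apply/eqP; rewrite eq_le measure_ge0 andbT.
apply/lee_addgt0Pr => e e0; rewrite add0e.
have K1 : (0 < K + 1)%R by rewrite ltr_wpDl.
have eK : (0 < e / (K + 1))%R by rewrite divr_gt0.
have : hausdorff_premeasure s delta A < (e / (K + 1))%:E.
  apply: (@le_lt_trans _ _ 0); last by rewrite lte_fin.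
  by rewrite -HA; apply: ereal_sup_ubound; exists delta.
move=> /ereal_inf_lt[_ [F [AF dF] <-] Fe].
have /choice[V HV] : forall i, exists V,
    [/\ measurable V, F i `<=` V & rho V <= K%:E * diam_pow s (F i)].
  by move=> i; exact: UV.
have mV i : measurable (V i) by have [] := HV i.
have AV : A `<=` \bigcup_i V i.
  by move=> x /AF[i _ Fx]; exists i => //; have [_ FV _] := HV i; exact: FV.
apply: (le_trans (measure_sigma_subadditive rho mV mA AV)).
apply: (@le_trans _ _ (\sum_(i <oo) K%:E * diam_pow s (F i))).
  by apply: lee_nneseries => // i _; have [] := HV i.
rewrite nneseriesZl//; last by move=> i _; exact: diam_pow_ge0.
apply: (@le_trans _ _ (K%:E * (e / (K + 1))%:E)).
  by rewrite lee_wpmul2l ?lee_fin// ltW.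
rewrite -EFinM lee_fin mulrCA ger_pMr// ler_pdivrMr// mul1r.
by rewrite lerDl.
Qed.

Lemma diam_ge0 U (y : 'rV[R]_k) : U y -> 0 <= diam U.
Proof.
move=> Uy; apply: ereal_sup_ubound; exists y => //; exists y => //.
by rewrite subrr normr0.
Qed.

Lemma sub_closed_ball_diam U (y : 'rV[R]_k) (r : R) : U y -> (0 < r)%R ->
  diam U <= r%:E -> U `<=` closed_ball y r.
Proof.
move=> Uy r0 dU x Ux; rewrite closed_ballE// /closed_ball_/= -lee_fin.
apply: le_trans dU; apply: ereal_sup_ubound.
by exists y => //; exists x.
Qed.

(** Decay at rate [gamma] along the radii [b ^- n] is decay of exponent
    [gamma / ln b] in the radius; the factor [b^2s] lost by rounding the diameter
    to such a radius is harmless. *)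
Lemma hausdorff_null_of_ball_decay A s b (N0 : nat) (gamma : R) :
  measurable A -> hausdorff_measure s A = 0 -> (0 <= s)%R -> (2 <= b)%N ->
  (s * ln b%:R <= gamma)%R ->
  rho setT <= 1 ->
  (forall N (y : 'rV[R]_k), (N0 <= N)%N ->
     rho (closed_ball y (b%:R ^- N.+1)%R) <= (expR (- (gamma * N%:R)))%:E) ->
  rho A = 0.
Proof.
move=> mA HA s0 b2 sg rho1 ball_decay.
have b1 : (1 < b%:R :> R)%R by rewrite ltr1n.
have b0 : (0 < b%:R :> R)%R by apply: lt_trans b1.
have lnb : (0 < ln (b%:R : R))%R by rewrite ln_gt0.
have bV n : (0 < (b%:R ^- n : R))%R by rewrite invr_gt0 exprn_gt0.
have bmono m n : (m <= n)%N -> ((b%:R ^- n : R) <= b%:R ^- m)%R.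
  by move=> mn; rewrite lef_pV2 ?posrE ?exprn_gt0// ler_weXn2l// ltW.
pose K : R := expR (2 * (s * ln b%:R)).
have K1 : (1 <= K)%R by rewrite -expR0 ler_expR !mulr_ge0// ltW.
have rhole V : measurable V -> rho V <= 1.
  by move=> mV; apply: le_trans rho1; apply: le_measure; rewrite ?inE.
apply: (mass_distribution mA HA (bV N0.+1) (expR_ge0 (2 * (s * ln b%:R)))).
move=> U dU; have [->|/set0P[y Uy]] := eqVneq U set0.
  exists set0; split => //; rewrite measure0 /diam_pow eqxx mule0//.
have Un0 : U != set0 by apply/set0P; exists y.
have dU0 := diam_ge0 Uy.
have dUfin : diam U \is a fin_num by rewrite ge0_fin_numE// (le_lt_trans dU)// ltry.
rewrite /diam_pow (negbTE Un0).
move: dU dU0; rewrite -(fineK dUfin); set D := fine (diam U).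
rewrite !lee_fin => dU; rewrite le_eqVlt => /predU1P[D0|D0].
  (* Diameter 0: [U] lies in a point, which is null unless [s = 0]; in that case
     the convention [0^0 = 1] makes the trivial bound by 1 sufficient. *)
  have Uball n : U `<=` closed_ball y (b%:R ^- n)%R.
    by apply: sub_closed_ball_diam => //; rewrite -(fineK dUfin) -/D -D0 lee_fin ltW.
  exists (\bigcap_n closed_ball y (b%:R ^- n)%R).
  have mI : measurable (\bigcap_n closed_ball y (b%:R ^- n : R)%R).
    by apply: bigcapT_measurable => n; exact: closed_ball_measurable.
  split => // [x Ux n _|]; first exact: Uball.
  have [s00|s00] := eqVneq s 0%R.
    rewrite s00 poweRe0 mule1.
    by apply: (le_trans (rhole _ mI)); rewrite lee_fin -s00.
  rewrite -D0 poweR0r// mule0.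
  have g0 : (0 < gamma)%R.
    by apply: lt_le_trans sg; rewrite mulr_gt0// lt0r s00.
  apply/lee_addgt0Pr => e e0; rewrite add0e.
  have [N NN] : exists N, (N0 <= N)%N /\ (expR (- (gamma * N%:R)) <= e)%R.
    exists (maxn N0 (Num.truncn (- ln e / gamma)).+1); split; first exact: leq_maxl.
    rewrite -[leRHS]lnK ?posrE// ler_expR lerNl mulrC -ler_pdivrMr//.
    rewrite (le_trans (ltW (truncnS_gt _)))// ler_nat leq_maxr//.
  have [N0N eN] := NN.
  apply: (@le_trans _ _ (rho (closed_ball y (b%:R ^- N.+1)%R))).
    apply: le_measure; rewrite ?inE//; first exact: closed_ball_measurable.
    by move=> x; apply.
  by apply: (le_trans (ball_decay _ _ N0N)); rewrite lee_fin.
have exn : exists n, (b%:R ^- n < D)%R.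
  exists (Num.truncn D^-1).+1; rewrite -[ltRHS]invrK.
  rewrite ltf_pV2 ?posrE ?invr_gt0 ?exprn_gt0//.
  by rewrite (lt_trans (truncnS_gt _))// -natrX ltr_nat ltn_expl.
(* The least [m] with [b ^- m < D] is written [N.+2], so that [D] lies between
   [b ^- N.+2] and [b ^- N.+1]. *)
case: (ex_minnP exn) => m mD mmin.
have mN0 : (N0.+1 < m)%N.
  by rewrite ltnNge; apply/negP => /bmono /(le_trans dU); rewrite leNgt mD.
have [N mN] : exists N, m = N.+2 by exists m.-2; case: m mN0 {mD mmin} => [|[]].
have N0N : (N0 <= N)%N by move: mN0; rewrite mN.
have DN : (D <= b%:R ^- N.+1)%R.
  by rewrite leNgt; apply/negP => /mmin; rewrite mN ltnn.
exists (closed_ball y (b%:R ^- N.+1)%R); split.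
- exact: closed_ball_measurable.
- by apply: sub_closed_ball_diam => //; rewrite -(fineK dUfin) lee_fin.
apply: (le_trans (ball_decay _ _ N0N)); rewrite poweR_EFin -EFinM lee_fin.
apply: (@le_trans _ _ (K * (b%:R ^- N.+2) `^ s)%R); last first.
  rewrite ler_wpM2l ?expR_ge0//; apply: ge0_ler_powR => //.
  - by rewrite nnegrE ltW.
  - by rewrite nnegrE ltW.
  - by rewrite ltW// -mN.
rewrite /powR gt_eqF// lnV ?posrE ?exprn_gt0// lnXn// -expRD ler_expR.
have -> : (ln (b%:R : R) *+ N.+2 = ln b%:R * (2 + N%:R))%R.
  by rewrite -[LHS]mulr_natr -natrD.
have : (s * ln b%:R * N%:R <= gamma * N%:R)%R by rewrite ler_wpM2r.
by lra.
Qed.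
End mass_distribution.

(** * Local entropy averages *)

Lemma limn_einf_gt (R : realType) (u : (\bar R)^nat) (a : \bar R) :
  (a < limn_einf u)%E -> exists N0, forall N, (N0 <= N)%N -> (a < u N)%E.
Proof.
rewrite limn_einf_lim (cvg_lim _ (@cvg_einfs_sup _ u))//.
move=> /ereal_sup_gt[_ [N0 _ <-]] aN0; exists N0 => N N0N.
by apply: (lt_le_trans aN0); apply: ereal_inf_lbound; exists N.
Qed.

Lemma int_box_gt0 k m : (0 < size (int_box k m))%N.
Proof.
have : 0 \in int_box k m by apply: mem_int_box => i; rewrite mxE normr0.
by case: (int_box k m).
Qed.

Section local_entropy_averages.
Context (R : realType) (d k : nat) (mu : probability 'rV[R]_d R).
Context (P : 'M[R]_d) (E : 'M[R]_(k, d)).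
Hypothesis hP : orthogonal_projection k P.
Hypothesis hE : orthonormal_basis P E.
Context (b : nat) (b2 : (2 <= b)%N).
Local Notation X := (fun n => @cell_index R d (b ^ n)).
Local Notation Z := (digit P E b).
Local Notation p := (digit_prob mu P E b).
Local Notation I := (info X Z p).
Local Notation f := (proj_coord P E).
Local Open Scope ereal_scope.

Let b0 : (0 < b)%N. Proof. exact: ltn_trans b2. Qed.

Let bn0 n : (0 < b ^ n)%N. Proof. by rewrite expn_gt0 b0. Qed.

Let mX n c : measurable (X n @^-1` [set c]).
Proof. exact: measurable_cell_index. Qed.

Let X_refines n (x y : 'rV[R]_d) : X n.+1 x = X n.+1 y -> X n x = X n y.
Proof. exact: cell_index_refines. Qed.

Let XZ n (x y : 'rV[R]_d) : X n.+1 x = X n.+1 y -> Z n x = Z n y.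
Proof. exact: digit_refines. Qed.

Let uS := @uniq_digits d k b.

Let ZS := mem_digits hP hE b0.

Let p01 n c z : (0 <= p n c z <= 1)%R. Proof. exact: digit_prob_01. Qed.

Let pE n c z : mu (X n @^-1` [set c] `&` Z n @^-1` [set z]) =
  (p n c z)%:E * mu (X n @^-1` [set c]).
Proof. exact: mu_cell_digit. Qed.

Let pS n c : (\sum_(z <- digits d k b) p n c z <= 1)%R.
Proof. exact: sum_digit_prob. Qed.

(** A point projected close to [y] has its first [N] digits close to those
    prescribed by [y] and by its own cells. *)
Lemma ball_info_le (beta : R) N (y : 'rV[R]_k) :
  mu ([set x | (beta * N%:R <= \sum_(1 <= n < N.+1) I n x)%R] `&`
      f @^-1` closed_ball y (b%:R ^- N.+1)%R) <=
  (expR (- ((beta - ln (size (int_box k d.+1))%:R) * N%:R)))%:E.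
Proof.
set L := size _; have L0 : (0 < L%:R :> R)%R by rewrite ltr0n int_box_gt0.
have bN0 : (0 < b%:R ^- N.+1 :> R)%R by rewrite invr_gt0 exprn_gt0// ltr0n.
pose S' n c := [seq (target_digit P E b n y c + v)%R | v <- int_box k d.+1].
have SL n c : (size (S' n c) <= L)%N by rewrite size_map.
have -> : (expR (- ((beta - ln L%:R) * N%:R)) =
           expR (- (beta * N%:R)) * L%:R ^+ N)%R.
  rewrite -{2}[L%:R](lnK L0) -expRM_natr -expRD.
  by congr expR; ring.
apply: le_trans (constrained_info_le mX X_refines XZ uS ZS p01 pE N beta SL).
apply: le_measure; rewrite ?inE.
- apply: measurableI; first exact: measurable_sum_info_ge.
  rewrite -[Y in measurable Y]setTI; apply: measurable_proj_coord => //.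
  exact: closed_ball_measurable.
- exact: measurable_constrained.
move=> x [/= xN]; rewrite closed_ballE// /closed_ball_/= => xy.
split=> // n /andP[_ nN].
rewrite distrC in xy.
have := digit_near_target hP hE b0 nN xy.
by move=> h; apply/mapP; exists (Z n x - target_digit P E b n y (X n x))%R => //;
  rewrite addrC subrK.
Qed.

(** The normalization defining the scenery is genuine almost everywhere. *)
Lemma ae_cell_neq0 : {ae mu, forall x n, mu (X n @^-1` [set X n x]) != 0}.
Proof.
apply: ae_foralln => n.
apply: (@negligible_fiberwise _ _ _ _ _ (X n)) => c.
have [Q0|Q0] := eqVneq (mu (X n @^-1` [set c])) 0.
  by apply: (negligibleS (@subIsetr _ _ _)); apply/negligibleP.
rewrite (_ : _ `&` _ = set0); first exact: negligible_set0.
by apply/seteqP; split => // x [/= nQ xc]; apply: nQ; rewrite xc.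
Qed.

Local Notation L1 := (size (int_box k d)).

(** Passing from the entropies of the scenery to the mean information of the digits
    costs [size (int_box k d)] per level, and from the mean information to the
    information costs 1. *)
Lemma ae_sum_info_ge (alpha : R) :
  {ae mu, forall x, alpha%:E <
     limn_einf (fun N : nat => (N%:R^-1)%:E *
       \sum_(1 <= n < N.+1) entropy (b%:R^-1)%R
          (distribution (scenery mu b x n) (proj_coord P E)))} ->
  {ae mu, forall x, exists N0, forall N, (N0 <= N)%N ->
     ((alpha - L1%:R - 1) * N%:R <= \sum_(1 <= n < N.+1) I n x)%R}.
Proof.
move=> entropy_gt.
have info_gt := ae_info_gt_mean_info mX X_refines XZ uS ZS p01 pS pE.
near=> x.
have /limn_einf_gt[N1 HN1] : alpha%:E < limn_einf (fun N : nat => (N%:R^-1)%:E *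
       \sum_(1 <= n < N.+1) entropy (b%:R^-1)%R
          (distribution (scenery mu b x n) (proj_coord P E))).
  by near: x.
have [N2 HN2] : exists N0, forall N, (N0 <= N)%N ->
  (\sum_(1 <= n < N.+1) mean_info p (digits d k b) n (X n x) <
   \sum_(1 <= n < N.+1) I n x + N%:R)%R by near: x.
have Q0 : forall n, mu (X n @^-1` [set X n x]) != 0.
  by near: x; exact: ae_cell_neq0.
exists (maxn N1 (maxn N2 1)) => N; rewrite !geq_max => /and3P[N1N N2N N0].
have := HN1 _ N1N; have {HN2} := HN2 _ N2N.
have Npos : (0 < N%:R :> R)%R by rewrite ltr0n.
have entropy_le : \sum_(1 <= n < N.+1) entropy (b%:R^-1)%R
      (distribution (scenery mu b x n) (proj_coord P E)) <=
    (\sum_(1 <= n < N.+1) mean_info p (digits d k b) n (X n x)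
       + L1%:R * N%:R)%:E.
  apply: (@le_trans _ _ (\sum_(1 <= n < N.+1)
      (mean_info p (digits d k b) n (X n x) + L1%:R)%:E)).
    by apply: lee_sum => n _; exact: entropy_scenery_le.
  by rewrite sumEFin big_split/= sumr_const_nat subSS subn0 mulr_natr.
rewrite muleC lte_pdivlMr// => h1 /lt_le_trans/(_ entropy_le).
rewrite -EFinM lte_fin => h2.
by lra.
Unshelve. all: by end_near. Qed.

(** The decay of balls holds uniformly only for the measure restricted to a set
    [G N0] on which the information is large from level [N0] on; these sets
    exhaust the space up to a null set. *)
Lemma hausdorff_null_preimage (alpha s : R) (A : set 'rV[R]_k) :
  {ae mu, forall x, alpha%:E <
     limn_einf (fun N : nat => (N%:R^-1)%:E *
       \sum_(1 <= n < N.+1) entropy (b%:R^-1)%R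
          (distribution (scenery mu b x n) (proj_coord P E)))} ->
  measurable A -> (0 <= s)%R ->
  (s * ln b%:R <= alpha - L1%:R - 1 - ln (size (int_box k d.+1))%:R)%R ->
  hausdorff_measure s A = 0 -> mu (f @^-1` A) = 0.
Proof.
move=> /ae_sum_info_ge; set beta := (alpha - L1%:R - 1)%R => sum_info_ge.
move=> mA s0 s_le HA.
pose G N0 := \bigcap_(N in [set N | (N0 <= N)%N])
  [set x | (beta * N%:R <= \sum_(1 <= n < N.+1) I n x)%R].
have mG N0 : measurable (G N0).
  apply: bigcap_measurable => [|N _]; first by exists N0 => /=.
  exact: measurable_sum_info_ge.
have mfA (B : set 'rV[R]_k) : measurable B -> measurable (f @^-1` B).
  by move=> mB; rewrite -[Y in measurable Y]setTI; exact: measurable_proj_coord.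
have GA0 N0 : mu (f @^-1` A `&` G N0) = 0.
  pose image : {measure set 'rV[R]_k -> \bar R} :=
    pushforward (mrestr mu (mG N0)) f.
  pose rho := image (measurable_proj_coord P E).
  suff : rho A = 0 by [].
  apply: (@hausdorff_null_of_ball_decay _ _ rho A s b N0 _ mA HA s0 b2 s_le).
    rewrite /rho/= /pushforward/= /mrestr; apply: probability_le1.
    by apply: measurableI => //; exact: mfA.
  move=> N y N0N; apply: le_trans (ball_info_le beta N y).
  rewrite /rho/= /pushforward/= /mrestr; apply: le_measure; rewrite ?inE.
  - by apply: measurableI => //; apply: mfA; exact: closed_ball_measurable.
  - apply: measurableI; first exact: measurable_sum_info_ge.
    by apply: mfA; exact: closed_ball_measurable.
  by move=> x [xy GN0]; split => //; exact: GN0.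
apply/negligibleP; first exact: mfA.
have : mu.-negligible (\bigcup_N0 (f @^-1` A `&` G N0)).
  apply: negligible_bigcup => N0; apply/negligibleP; last exact: GA0.
  by apply: measurableI => //; exact: mfA.
move=> UG.
have : mu.-negligible (~` [set x | exists N0, forall N, (N0 <= N)%N ->
    (beta * N%:R <= \sum_(1 <= n < N.+1) I n x)%R] `|`
    \bigcup_N0 (f @^-1` A `&` G N0)) by exact: negligibleU.
apply: negligibleS => x Ax.
have [[N0 HN0]|nx] := pselect (exists N0, forall N, (N0 <= N)%N ->
    (beta * N%:R <= \sum_(1 <= n < N.+1) I n x)%R); last by left.
by right; exists N0 => //; split.
Qed.

End local_entropy_averages.

Local Open Scope ereal_scope.

Theorem theorem1p9 (R : realType) (d k : nat) (hk : (1 <= k)%N) (hkd : (k <= d)%N) :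
  exists C : R,
    forall (mu : probability 'rV[R]_d R) (b : nat) (P : 'M[R]_d)
           (E : 'M[R]_(k, d)) (alpha : R),
      (2 <= b)%N ->
      orthogonal_projection k P ->
      orthonormal_basis P E ->
      {ae mu, forall x : 'rV[R]_d,
        alpha%:E <
        limn_einf (fun N : nat => (N%:R^-1)%:E *
          \sum_(1 <= n < N.+1)
             entropy (b%:R^-1) (distribution (scenery mu b x n) (proj_coord P E)))} ->
      (alpha / ln b%:R - C / ln b%:R)%:E <
        lower_dim (distribution mu (proj_coord P E)).
Proof.
pose C0 : R :=
  ((size (int_box k d))%:R + 1 + ln (size (int_box k d.+1))%:R)%R.
exists (C0 + 1)%R => mu b P E alpha b2 hP hE entropy_gt.
have lnb : (0 < ln (b%:R : R))%R by rewrite ln_gt0 ?ltr1n.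
apply: (@lt_le_trans _ _ ((alpha - C0) / ln b%:R)%:E).
  rewrite lte_fin -mulrBl ltr_pM2r ?invr_gt0//.
  by lra.
apply: le_ereal_inf_tmp => _ [A [mA A0] <-].
apply: le_ereal_inf_tmp => _ [s [s0 HA] <-].
rewrite lee_fin leNgt; apply/negP; rewrite ltr_pdivlMr// => s_lt.
have : mu (proj_coord P E @^-1` A) = 0.
  apply: (hausdorff_null_preimage hP hE b2 entropy_gt mA s0 _ HA).
  by move: s_lt; rewrite /C0; lra.
move=> muA; have : 0 < (0 : \bar R) by rewrite -[ltRHS]muA.
by rewrite ltxx.
Qed.
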